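(* Suppose that $f$ is $\mu$-strongly convex and its gradient is $L$-Lipschitz. Let $0<a=\gamma L^{-1}$ and $0<b=\frac{(1+\gamma)\mu^{-1}-2\gamma L^{-1}}{1-\gamma}$, where $0<\gamma<1$ is the parameter of the algorithm. Assume that $0<\underline{\kappa}\le\kappa_k\le\overline{\kappa}<2(Lb)^{-1}$. Let $\alpha=1-\frac{Lb\overline{\kappa}}{2}$ and $\eta=\frac{L}{2\gamma\mu\underline{\kappa}}$. Then the sequence of iterates $(x_k)_{k\in\mathbb{N}}$ of the zero-memory SR1 (0SR1) forward–backward algorithm with $t=1$ (described in the context) converges linearly to the unique minimizer $x^\star$ of $F=f+h$, i.e. $$\|x_k-x^\star\|\le\sqrt{\frac{2(F(x_0)-F(x^\star))}{\mu}}\;\rho^{k/2},$$ where $$\rho=\begin{cases}\rho_1&\text{for }\alpha\in\,]0,1/2[\\ \min(\rho_1,\rho_2)&\text{for }\alpha\in[1/2,1[\end{cases}$$ with $$\rho_1=1-\alpha\Big(1-2\big(\sqrt{\eta^2+\eta}-\eta\big)\Big),\qquad \rho_2=\begin{cases}2\eta\ (\le 1/2)&\text{if }\eta\le1/4\\ 1-\frac{1}{8\eta}&\text{otherwise.}\end{cases}$$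
   Context: Problem: minimize $F=f+h$ over $\mathbb{R}^N$, where $f,h\in\Gamma_0(\mathbb{R}^N)$ (proper lower semicontinuous convex functions $\mathbb{R}^N\to\mathbb{R}\cup\{+\infty\}$), $f$ is continuously differentiable with $L$-Lipschitz gradient, and the set of minimizers of $F$ is nonempty. For $B$ symmetric positive definite, $\|x\|_B^2=\langle x,Bx\rangle$ and $\mathrm{prox}^B_g(x)=\operatorname{argmin}_z\{g(z)+\tfrac12\|x-z\|_B^2\}$. 0SR1 forward–backward algorithm. Inputs: $x_0\in\operatorname{dom}(f+h)$, stopping tolerance $\epsilon$, step sizes $\kappa_k$, and parameters $0<\gamma<1$, $0<\tau_{\min}<\tau_{\max}$. For $k=1,2,3,\dots$: set $s_k=x_k-x_{k-1}$, $y_k=\nabla f(x_k)-\nabla f(x_{k-1})$; compute $H_k$ as below; set $B_k=H_k^{-1}$ and $\bar x_{k+1}=\mathrm{prox}^{B_k}_{\kappa_k h}(x_k-\kappa_kH_k\nabla f(x_k))$; set $p_k=\bar x_{k+1}-x_k$ and terminate if $\|p_k\|<\epsilon$; set $x_{k+1}=x_k+tp_k$ (so with $t=1$, $x_{k+1}=\bar x_{k+1}$). Computation of $H_k$ (the base matrix $H_0$ is recomputed at each $k$): if $k=1$, $H_0=\tau\,\mathrm{Id}$ with $\tau>0$ arbitrary and $u_k=0$. Otherwise, let $\tau_{\mathrm{BB2}}=\langle s_k,y_k\rangle/\|y_k\|^2$ (Barzilai–Borwein step length), project $\tau_{\mathrm{BB2}}$ onto $[\tau_{\min},\tau_{\max}]$,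 and set $H_0=\gamma\tau_{\mathrm{BB2}}\mathrm{Id}$; if $\langle s_k-H_0y_k,y_k\rangle\le10^{-8}\|y_k\|\,\|s_k-H_0y_k\|$ set $u_k=0$ (the update is skipped), else set $u_k=(s_k-H_0y_k)/\sqrt{\langle s_k-H_0y_k,y_k\rangle}$. In all cases $H_k=H_0+u_ku_k^\top$.
   Formalization: Adds a ≤ τ ≤ b (the claim fails for arbitrary τ > 0) and τ_min ≤ 1/L ≤ τ_max (it fails if the safeguard spoils the BB step); x_1 is obtained from x_0 by one step with H = τ Id; the bound is claimed for iterates reached before termination. *)

(* Defs.v *)
From mathcomp Require Export all_boot all_order all_algebra.
From mathcomp Require Export all_classical all_reals all_analysis.
Export Order.TTheory GRing.Theory Num.Theory numFieldNormedType.Exports.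

Set Implicit Arguments.
Unset Strict Implicit.
Unset Printing Implicit Defensive.

Local Open Scope classical_set_scope.
Local Open Scope ring_scope.

(* The norm that MathComp-Analysis puts on 'cV[R]_N is the sup norm.  It induces
   the usual topology and is used only for that (differentiability, continuity,
   lower semicontinuity); every quantitative notion uses [enorm]. *)
Definition dot (R : realType) (N : nat) (x y : 'cV[R]_N) : R :=
  \sum_(i < N) x i 0 * y i 0.

Definition enorm (R : realType) (N : nat) (x : 'cV[R]_N) : R :=
  Num.sqrt (dot x x).

Definition sqnormB (R : realType) (N : nat) (B : 'M[R]_N) (x : 'cV[R]_N) : R :=
  dot x (B *m x).

Section functions.
Variables (R : realType) (N : nat).
Implicit Types (f : 'cV[R]_N -> R) (g h : 'cV[R]_N -> \bar R).

Definition proper g := (forall x, g x != -oo%E) /\ (exists x, (g x < +oo)%E).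

(* The values -oo are excluded by [proper], so the right-hand side is never
   of the form +oo + -oo. *)
Definition convex_ereal g := forall x y (t : R), 0 <= t <= 1 ->
  (g (t *: x + (1 - t) *: y)%R <= t%:E * g x + (1 - t)%:E * g y)%E.

Definition Gamma0 g := [/\ proper g, lower_semicontinuous g & convex_ereal g].

Definition strongly_convex (mu : R) f := forall x y (t : R), 0 <= t <= 1 ->
  f (t *: x + (1 - t) *: y) <=
    t * f x + (1 - t) * f y - mu / 2 * (t * (1 - t)) * enorm (x - y) ^+ 2.

Definition grad f (x : 'cV[R]_N) : 'cV[R]_N :=
  \col_i ('d (f : 'cV[R]_N -> R^o) x (delta_mx i 0 : 'cV[R]_N)).

Definition C1 f :=
  (forall x, differentiable (f : 'cV[R]_N -> R^o) x) /\ continuous (grad f).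

Definition elipschitz (L : R) (G : 'cV[R]_N -> 'cV[R]_N) :=
  forall x y, enorm (G x - G y) <= L * enorm (x - y).

Definition objective f h : 'cV[R]_N -> \bar R := fun x => ((f x)%:E + h x)%E.

Definition is_argmin g (x : 'cV[R]_N) := forall z, (g x <= g z)%E.

Definition is_prox (B : 'M[R]_N) g (x p : 'cV[R]_N) :=
  is_argmin (fun z => (g z + (2^-1 * sqnormB B (x - z))%:E)%E) p.

End functions.

Section zero_memory_SR1.
Variables (R : realType) (N : nat).
Implicit Types (s y : 'cV[R]_N) (x xbar : nat -> 'cV[R]_N).

Definition project (lo hi v : R) : R := Num.max lo (Num.min hi v).

(* For y = 0 the quotient is 0 (x / 0 = 0), and the scale is gamma * tmin.
   When grad f is the gradient of a strongly convex f this only happens after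
   two equal consecutive iterates. *)
Definition bb2_scale (gamma tmin tmax : R) s y : R :=
  gamma * project tmin tmax (dot s y / enorm y ^+ 2).

Definition sr1_vector (H0 : 'M[R]_N) s y : 'cV[R]_N :=
  let r := s - H0 *m y in
  if dot r y <= 10 ^- 8 * enorm y * enorm r then 0
  else (Num.sqrt (dot r y))^-1 *: r.

Definition sr1_matrix (H0 : 'M[R]_N) s y : 'M[R]_N :=
  let u := sr1_vector H0 s y in H0 + u *m u^T.

(* The loop of the algorithm starts at k = 1 and reads both x_0 and x_1,
   although only x_0 is an input.  The point x_1 is produced by running the
   body of the loop once more, for k = 0, with the same matrix tau Id as for
   k = 1, since there is no curvature pair yet. *)
Definition zsr1_H (gamma tmin tmax tau : R) (G : 'cV[R]_N -> 'cV[R]_N) x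
    (k : nat) : 'M[R]_N :=
  if (k <= 1)%N then tau%:M
  else
    let s := x k - x k.-1 in
    let y := G (x k) - G (x k.-1) in
    sr1_matrix (bb2_scale gamma tmin tmax s y)%:M s y.

(* x_k is computed, i.e. no iteration 1 <= j < k has triggered the stopping
   test || xbar_{j+1} - x_j || < eps.  With eps = 0 the run never stops. *)
Definition reached (eps : R) x xbar (k : nat) :=
  forall j, (1 <= j < k)%N -> eps <= enorm (xbar j.+1 - x j).

Definition zsr1_run (gamma tmin tmax tau eps t : R) (kappa : nat -> R)
    (f : 'cV[R]_N -> R) (h : 'cV[R]_N -> \bar R) x xbar :=
  forall k, reached eps x xbar k ->
    let H := zsr1_H gamma tmin tmax tau (grad f) x k in
    is_prox (invmx H) (fun z => ((kappa k)%:E * h z)%E)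
      (x k - kappa k *: (H *m grad f (x k))) (xbar k.+1) /\
    (reached eps x xbar k.+1 -> x k.+1 = x k + t *: (xbar k.+1 - x k)).

End zero_memory_SR1.

(* Main.v *)
Require Import Defs.
From mathcomp Require Import ring lra.

(* Let xs be a minimizer, B = H_k^-1, |v|_B^2 = <v, B v>, d = x_{k+1} - x_k,
   delta_k = F(x_k) - F(xs) and D = <grad f(x_k), d> + h(x_{k+1}) - h(x_k).  The
   variational inequality of the prox, tested at x_k and at xs and averaged with
   weights 1 - t and t, gives
     D <= - t delta_k + (t <B d, xs - x_k> - |d|_B^2) / kappa_k.
   The descent lemma and H_k <= b give
     delta_{k+1} <= delta_k + D + (1 - alpha) |d|_B^2 / kappa_k <= delta_k + alpha D.
   By Young's inequality, H_k >= a and the growth mu/2 |x_k - xs|^2 <= delta_k, the second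
   bound yields the factor 1 - alpha (t - eta t^2), and when alpha >= 1/2 the first one
   yields 1 - (t - 2 eta t^2); the rates rho1 and rho2 come from a suitable t.
   The bounds a <= H_k <= b follow from 1/L <= tau_BB2 <= 1/mu (cocoercivity and strong
   monotonicity of grad f). *)

Set Implicit Arguments.
Unset Strict Implicit.
Unset Printing Implicit Defensive.

Local Open Scope ring_scope.

(** * Euclidean inner product and norm *)

Section dot_theory.
Variables (R : realType) (N : nat).
Implicit Types (x y z : 'cV[R]_N) (A : 'M[R]_N).

Lemma dotE x y : dot x y = (x^T *m y) 0 0.
Proof. by rewrite mxE; apply: eq_bigr => i _; rewrite mxE. Qed.

Lemma dotC x y : dot x y = dot y x.
Proof. by apply: eq_bigr => i _; rewrite mulrC. Qed.

Lemma dotDl x y z : dot (x + y) z = dot x z + dot y z.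
Proof. by rewrite !dotE linearD mulmxDl mxE. Qed.

Lemma dotDr x y z : dot x (y + z) = dot x y + dot x z.
Proof. by rewrite !dotE mulmxDr mxE. Qed.

Lemma dotNl x y : dot (- x) y = - dot x y.
Proof. by rewrite !dotE linearN mulNmx mxE. Qed.

Lemma dotNr x y : dot x (- y) = - dot x y.
Proof. by rewrite !dotE mulmxN mxE. Qed.

Lemma dotZl (c : R) x y : dot (c *: x) y = c * dot x y.
Proof. by rewrite !dotE linearZ /= -scalemxAl mxE. Qed.

Lemma dotZr (c : R) x y : dot x (c *: y) = c * dot x y.
Proof. by rewrite !dotE -scalemxAr mxE. Qed.

Definition dot_linE := (dotDl, dotDr, dotNl, dotNr, dotZl, dotZr).

Lemma dot0r x : dot x 0 = 0.
Proof. by rewrite -(scale0r x) dotZr mul0r. Qed.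

Lemma dot_mulmx A x y : dot (A *m x) y = dot x (A^T *m y).
Proof. by rewrite !dotE trmx_mul mulmxA. Qed.

Lemma dot_outer u x y : dot x (u *m u^T *m y) = dot u x * dot u y.
Proof.
rewrite -mulmxA (mx11_scalar (u^T *m y)) -dotE.
by rewrite mul_mx_scalar dotZr (dotC x) mulrC.
Qed.

Lemma dot_ge0 x : 0 <= dot x x.
Proof. by apply: sumr_ge0 => i _; rewrite -expr2 sqr_ge0. Qed.

Lemma dot_eq0 x : dot x x = 0 -> x = 0.
Proof.
move=> /eqP; rewrite psumr_eq0 => [|i _]; last by rewrite -expr2 sqr_ge0.
move=> /allP x0; apply/matrixP => i j; rewrite ord1 mxE; apply/eqP.
by have := x0 i (mem_index_enum i); rewrite /= -expr2 sqrf_eq0.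
Qed.

Lemma enorm_ge0 x : 0 <= enorm x.
Proof. exact: sqrtr_ge0. Qed.

Lemma enorm_sqr x : enorm x ^+ 2 = dot x x.
Proof. by rewrite sqr_sqrtr ?dot_ge0. Qed.

Lemma dot_CS x y : dot x y ^+ 2 <= dot x x * dot y y.
Proof.
(* This squared norm equals [dot y y] times the Cauchy-Schwarz gap, so one may divide by [dot y y]
   unless [y = 0]. *)
have := dot_ge0 (dot y y *: x - dot x y *: y).
rewrite !dot_linE (dotC y x) => h.
have [y0|] := eqVneq (dot y y) 0.
  by rewrite (dot_eq0 y0) !dot0r expr0n mulr0.
move=> yn0; have y0 : 0 < dot y y by rewrite lt_neqAle eq_sym yn0 dot_ge0.
rewrite -subr_ge0 -(pmulr_rge0 _ y0); apply: le_trans h _.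
by rewrite le_eqVlt; apply/orP; left; apply/eqP; ring.
Qed.

Lemma dot_le_enorm x y : dot x y <= enorm x * enorm y.
Proof.
rewrite -sqrtrM ?dot_ge0//; apply: le_trans (ler_norm _) _.
by rewrite -sqrtr_sqr ler_sqrt ?dot_CS// mulr_ge0 ?dot_ge0.
Qed.

End dot_theory.

(** * First-order inequalities for smooth strongly convex functions *)

Section gradient.
Local Open Scope classical_set_scope.
Local Open Scope ring_scope.
Variables (R : realType) (N : nat) (f : 'cV[R]_N -> R).
Hypothesis f_diff : forall x, differentiable (f : 'cV[R]_N -> R^o) x.
Implicit Types x v z : 'cV[R]_N.

Lemma diff_grad x v : 'd (f : 'cV[R]_N -> R^o) x v = dot (grad f x) v.
Proof.
rewrite [in LHS](matrix_sum_delta v) linear_sum.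
apply: eq_bigr => i _; rewrite big_ord1 linearZ mxE /=.
by rewrite mulrC.
Qed.

Lemma is_derive_line x v (t : R) :
  is_derive t 1 (fun s : R => f (x + s *: v) : R) (dot (grad f (x + t *: v)) v).
Proof.
have E : (fun h : R => h^-1 *: (((fun s : R => f (x + s *: v)) \o shift t) (h *: 1)
      - f (x + t *: v))) =
    (fun h : R => h^-1 *: (((f : _ -> R^o) \o shift (x + t *: v)) (h *: v) -
      f (x + t *: v))).
  apply/funext => h /=; congr (_ *: (f _ - _)).
  by rewrite scalerDl addrCA [h *: 1]mulr1.
have dv := @diff_derivable _ _ _ _ _ v (f_diff (x + t *: v)).
have := deriveE v (f_diff (x + t *: v)); rewrite diff_grad => Dv.
by apply: DeriveDef; [rewrite /derivable E|rewrite -Dv /derive E].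
Qed.

(** Dividing by [t] and letting [t] tend to 0 from the right removes the second-order term. This
    turns convexity along a segment into a gradient inequality. *)
Lemma grad_le_quotient x v (C K : R) :
  (forall t, 0 < t < 1 -> f (x + t *: v) - f x <= t * C + t ^+ 2 * K) ->
  dot (grad f x) v <= C.
Proof.
move=> hC; have [] := is_derive_line x v 0.
rewrite scale0r addr0 => dv Dv; rewrite -Dv.
have /cvg_dnbhs_at_right cq := dv.
have cK : (C + t * K) @[t --> (0 : R)^'+] --> C.
  apply: cvg_at_right_filter; rewrite -[X in _ --> X]addr0 -[X in _ + X](mul0r K).
  by apply: cvgD; [exact: cvg_cst|apply: cvgMl; exact: cvg_id].
apply: (ler_cvg_to cq cK); near=> t.
have t0 : 0 < t by near: t; exact: nbhs_right_gt.
have t1 : t < 1 by near: t; exact: nbhs_right_lt.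
rewrite /= scale0r addr0 [t *: 1]mulr1 addr0 [_ *: _]mulrC ler_pdivrMr//.
have := hC t; rewrite t0 t1 => /(_ isT) /le_trans; apply.
by rewrite le_eqVlt; apply/orP; left; apply/eqP; ring.
Unshelve. all: by end_near. Qed.

Lemma strongly_convex_grad (mu : R) x z : strongly_convex mu f ->
  f x + dot (grad f x) (z - x) + mu / 2 * dot (z - x) (z - x) <= f z.
Proof.
move=> sc; set q := dot (z - x) (z - x).
suff : dot (grad f x) (z - x) <= f z - f x - mu / 2 * q by lra.
apply: (@grad_le_quotient x _ _ (mu / 2 * q)) => t /andP[t0 t1].
have : 0 <= t <= 1 by rewrite !ltW.
move=> /(sc z x t); rewrite enorm_sqr -/q.
have -> : t *: z + (1 - t) *: x = x + t *: (z - x).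
  by apply/matrixP => i j; rewrite !mxE; ring.
lra.
Qed.

(** Descent lemma, obtained by monotonicity instead of integration: on the segment, f minus its
    quadratic upper model is the function [phi], whose derivative is nonpositive by Cauchy-Schwarz
    and the Lipschitz bound. *)
Lemma lipschitz_grad_ub (L : R) x z : elipschitz L (grad f) ->
  f z <= f x + dot (grad f x) (z - x) + L / 2 * dot (z - x) (z - x).
Proof.
move=> lip; set v := z - x; set c := dot (grad f x) v; set q := dot v v.
pose phi : R -> R := (fun s : R => f (x + s *: v) : R) - 
  ((fun s => s * c) + (fun s => s ^+ 2 * (L / 2 * q))).
have dphi (t : R) : is_derive t 1 phi
    (dot (grad f (x + t *: v)) v - (c + t * (L * q))).
  have dl := is_derive_line x v t.
  have d1 : is_derive t 1 (fun s : R => s * c) c.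
    by apply: is_derive_eq; rewrite scaler0 add0r [LHS]mulr1.
  have d2 : is_derive t 1 (fun s : R => s ^+ 2 * (L / 2 * q)) (t * (L * q)).
    by apply: is_derive_eq; rewrite scaler0 add0r /GRing.scale/=; field.
  exact: (is_deriveB dl (is_deriveD d1 d2)).
have phi_le t : 0 < t < 1 -> dot (grad f (x + t *: v)) v - (c + t * (L * q)) <= 0.
  move=> /andP[t0 t1]; rewrite opprD addrA /c -dotNl -dotDl subr_le0.
  apply: le_trans (dot_le_enorm _ _) _.
  have := lip (x + t *: v) x; rewrite [x + _]addrC addrK.
  have -> : enorm (t *: v) = t * enorm v.
    rewrite /enorm dotZl dotZr mulrA sqrtrM ?mulr_ge0 ?ltW//.
    by rewrite -expr2 sqrtr_sqr gtr0_norm.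
  move=> /(ler_wpM2r (enorm_ge0 v)) /le_trans; apply.
  by rewrite /q -enorm_sqr le_eqVlt; apply/orP; left; apply/eqP; ring.
have : phi 1 <= phi 0.
  apply: (@ler0_derive1_nincr _ phi 0 1) => //.
  - move=> t; rewrite in_itv/= derive1E => t01.
    by case: (dphi t) => _ ->; exact: phi_le.
  - apply: continuous_subspaceT => s.
    apply: differentiable_continuous; apply/derivable1_diffP.
    by case: (dphi s).
rewrite /phi !fctE scale1r scale0r addr0 /v [x + _]addrC subrK.
by rewrite -/v expr1n expr0n/= !mul1r !mul0r addr0 subr0; lra.
Qed.

Lemma grad_strongly_monotone (mu : R) x z : strongly_convex mu f ->
  mu * dot (z - x) (z - x) <= dot (z - x) (grad f z - grad f x).
Proof.
move=> sc; have := strongly_convex_grad x z sc; have := strongly_convex_grad z x sc.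
have -> : x - z = - (z - x) by rewrite opprB.
move: (grad f x) (grad f z) (z - x) => gx gz v.
rewrite dotNl !dotNr opprK dotDr dotNr (dotC v gx) (dotC v gz).
lra.
Qed.

(** The value of f at [w], a step of length 1/L from [z] along minus the gradient difference, is
    bounded below by convexity at [x] and above by the descent lemma at [z]. *)
Lemma convex_grad_sqr (mu L : R) x z : 0 <= mu -> 0 < L ->
  strongly_convex mu f -> elipschitz L (grad f) ->
  f x + dot (grad f x) (z - x) +
    (2 * L)^-1 * dot (grad f z - grad f x) (grad f z - grad f x) <= f z.
Proof.
move=> mu0 L0 sc lip; set y := grad f z - grad f x.
pose w := z - L^-1 *: y.
have l1 := strongly_convex_grad x w sc.
have l2 := lipschitz_grad_ub z w lip.
have hw : 0 <= mu / 2 * dot (w - x) (w - x).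
  by rewrite mulr_ge0 ?dot_ge0// divr_ge0.
have ez : w - z = - (L^-1 *: y) by rewrite /w addrC addKr.
have ex : w - x = (z - x) - L^-1 *: y by rewrite /w addrAC.
rewrite ez in l2; rewrite ex in l1 hw.
have yE : dot (grad f z) y - dot (grad f x) y = dot y y by rewrite -dotNl -dotDl.
have : L / 2 * (L^-1 * (L^-1 * dot y y)) = L^-1 * dot y y / 2 by field; rewrite gt_eqF.
have -> : (2 * L)^-1 * dot y y = L^-1 * dot y y / 2 by field; rewrite gt_eqF.
have : L^-1 * dot (grad f z) y - L^-1 * dot (grad f x) y = L^-1 * dot y y.
  by rewrite -mulrBr yE.
clearbody y; move: (grad f x) (grad f z) l1 l2 {yE} => gx gz.
rewrite [dot gx (_ - _ *: _)]dotDr !dotNr !dotNl !dotZr !dotZl.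
lra.
Qed.

(** Baillon-Haddad inequality: the previous bound is added to itself with [x] and [z] exchanged. *)
Lemma grad_cocoercive (mu L : R) x z : 0 <= mu -> 0 < L ->
  strongly_convex mu f -> elipschitz L (grad f) ->
  L^-1 * dot (grad f z - grad f x) (grad f z - grad f x) <=
    dot (z - x) (grad f z - grad f x).
Proof.
move=> mu0 L0 sc lip.
have := convex_grad_sqr x z mu0 L0 sc lip.
have := convex_grad_sqr z x mu0 L0 sc lip.
move: (grad f x) (grad f z) => gx gz.
rewrite -(opprB gz gx) -(opprB z x); move: (z - x) => v.
rewrite dotNl !dotNr opprK invfM [dot v _]dotDr dotNr (dotC v gx) (dotC v gz).
lra.
Qed.

End gradient.

(** * Quadratic-form bounds for inverses and for the SR1 matrix *)

Section spectral_bounds.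
Variables (R : realType) (N : nat).
Implicit Types (s y v : 'cV[R]_N) (H : 'M[R]_N).

Definition spectral_ge (a : R) H := forall v, a * dot v v <= dot v (H *m v).
Definition spectral_le (b : R) H := forall v, dot v (H *m v) <= b * dot v v.

Lemma spectral_ge_unitmx (a : R) H : 0 < a -> spectral_ge a H -> H \in unitmx.
Proof.
move=> a0 Ha; rewrite -unitmx_tr -row_free_unit.
apply: inj_row_free => v vH; have := Ha v^T.
rewrite -[H]trmxK -trmx_mul vH trmx0 dot0r pmulr_rle0// => v0.
by rewrite -[v]trmxK (@dot_eq0 _ _ v^T) ?trmx0//; apply/eqP; rewrite eq_le v0 dot_ge0.
Qed.

Lemma spectral_ge_inv (a : R) H : 0 < a -> spectral_ge a H -> spectral_le a^-1 (invmx H).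
Proof.
move=> a0 Ha e; set w := invmx H *m e.
have He : H *m w = e by rewrite mulKVmx// (spectral_ge_unitmx a0 Ha).
have := Ha w; rewrite He (dotC w) => h.
(* In the expanded square, a^2 |w|^2 is at most a <e, w>, which leaves a <e, w> <= |e|^2. *)
have := dot_ge0 (a *: w - e); rewrite !dot_linE (dotC w e).
have : a * (a * dot w w) <= a * dot e w by rewrite ler_pM2l.
rewrite -/w ler_pdivlMl//; lra.
Qed.

Lemma spectral_le_inv (a b : R) H : 0 < a -> 0 < b -> H^T = H ->
  spectral_ge a H -> spectral_le b H -> spectral_ge b^-1 (invmx H).
Proof.
move=> a0 b0 sH Ha Hb d; set w := invmx H *m d.
have Hd : H *m w = d by rewrite mulKVmx// (spectral_ge_unitmx a0 Ha).
have wHd : dot w (H *m d) = dot d d by rewrite -{1}sH -dot_mulmx Hd.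
(* Expanding gives <d, w> >= 2/b |d|^2 - <d, H d>/b^2, and the last term is at most |d|^2/b. *)
have h : 0 <= dot (w - b^-1 *: d) (H *m (w - b^-1 *: d)).
  by apply: le_trans (Ha _); rewrite mulr_ge0 ?dot_ge0// ltW.
have := Hb d; move: h.
rewrite mulmxBr -scalemxAr Hd !dot_linE wHd (dotC w d) => h hb.
have : b^-1 * (b^-1 * dot d (H *m d)) <= b^-1 * dot d d.
  by rewrite ler_pM2l ?invr_gt0// ler_pdivrMl.
lra.
Qed.

Lemma trmx_sr1 (c : R) s y : (sr1_matrix c%:M s y)^T = sr1_matrix c%:M s y.
Proof. by rewrite /sr1_matrix linearD /= tr_scalar_mx trmx_mul trmxK. Qed.

Lemma dot_scalar_mx (c : R) v : dot v (c%:M *m v) = c * dot v v.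
Proof. by rewrite mul_scalar_mx dotZr. Qed.

Lemma sr1_spectral_ge (c : R) s y : spectral_ge c (sr1_matrix c%:M s y).
Proof.
move=> v; rewrite /sr1_matrix mulmxDl dotDr dot_scalar_mx dot_outer.
by rewrite lerDl -expr2 sqr_ge0.
Qed.

(** By Cauchy-Schwarz, the form of c Id + u u^T is at most (c + |u|^2) times the squared norm, so it
    suffices to bound c + |u|^2. *)
Lemma sr1_spectral_le (gamma mu c : R) s y : 0 < gamma < 1 -> 0 < mu -> 0 <= c ->
  0 < dot s y -> mu * dot s s <= dot s y -> c <= gamma * mu^-1 ->
  c * dot y y <= gamma * dot s y ->
  spectral_le ((mu^-1 - c) / (1 - gamma)) (sr1_matrix c%:M s y).
Proof.
move=> /andP[g0 g1] mu0 c0 sy0 sc cmu cy.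
have g1' : 0 < 1 - gamma by lra.
suff : c + dot (sr1_vector c%:M s y) (sr1_vector c%:M s y) <=
    (mu^-1 - c) / (1 - gamma).
  move=> hu v; rewrite /sr1_matrix mulmxDl dotDr dot_scalar_mx dot_outer.
  apply: le_trans (ler_wpM2r (dot_ge0 v) hu).
  by rewrite mulrDl lerD2l -expr2 dot_CS.
rewrite ler_pdivlMr// /sr1_vector; case: ifPn => [_|].
  rewrite dot0r addr0.
  (* Skipped update: the claim is (2 - gamma) c <= 1/mu, which follows from c <= gamma/mu and gamma
     (2 - gamma) <= 1. *)
  have m0 : 0 < mu^-1 by rewrite invr_gt0.
  have := mulr_ge0 (ltW m0) (sqr_ge0 (1 - gamma)).
  have : (2 - gamma) * c <= (2 - gamma) * (gamma * mu^-1).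
    by rewrite ler_pM2l//; lra.
  lra.
set r := s - _; rewrite -ltNge => hD.
have D0 : 0 < dot r y.
  by apply: le_lt_trans hD; rewrite !mulr_ge0 ?enorm_ge0// exprn_ge0 ?invr_ge0.
have DE : dot r y = dot s y - c * dot y y by rewrite /r mul_scalar_mx dotDl dotNl dotZl.
have rE : dot r r = dot s s - 2 * c * dot s y + c ^+ 2 * dot y y.
  by rewrite /r mul_scalar_mx !dot_linE (dotC y s); ring.
rewrite dotZl dotZr mulrA -expr2 exprVn sqr_sqrtr ?(ltW D0)//.
rewrite -(ler_pM2r D0) mulrAC [(c + _) * _]mulrDl mulrAC mulVf ?gt_eqF// mul1r.
rewrite rE DE.
(* The claim is now (1 - gamma)(<s,s> - c <s,y>) <= (1/mu - c)(<s,y> - c <y,y>); the two facts that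
   follow add up to it. *)
have : (1 - gamma) * dot s s <= (1 - gamma) * (mu^-1 * dot s y).
  by rewrite ler_pM2l// ler_pdivlMl.
have : 0 <= (mu^-1 - c) * (gamma * dot s y - c * dot y y).
  rewrite mulr_ge0 ?subr_ge0//; apply: le_trans cmu _.
  by rewrite ger_pMl ?invr_gt0// ltW.
lra.
Qed.

Lemma spectral_le_trans (b b' : R) H : b <= b' -> spectral_le b H -> spectral_le b' H.
Proof. by move=> bb Hb v; apply: le_trans (Hb v) _; rewrite ler_wpM2r ?dot_ge0. Qed.

End spectral_bounds.

(** * Finiteness, proximal points and growth for extended-valued functions *)

Section extended_valued.
Variables (R : realType) (N : nat).
Implicit Types (f : 'cV[R]_N -> R) (h : 'cV[R]_N -> \bar R) (x p z : 'cV[R]_N).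

Lemma le0_of_le_sqr (A K : R) :
  (forall t, 0 < t < 1 -> t * A <= t ^+ 2 * K) -> A <= 0.
Proof.
move=> hA; rewrite leNgt; apply/negP => A0.
have K0 := normr_ge0 K; have KK := ler_norm K.
(* If A > 0, the value t = A / (2 A + |K|) lies in ]0,1[ and would force 2 A + |K| <= K. *)
have d0 : 0 < 2 * A + `|K| by lra.
have t0 : 0 < A / (2 * A + `|K|) by rewrite divr_gt0.
have := hA (A / (2 * A + `|K|)); rewrite t0 ltr_pdivrMr// mul1r.
have -> : A < 2 * A + `|K| by lra.
move=> /(_ isT); rewrite expr2 -mulrA ler_pM2l// mulrAC ler_pdivlMr//.
by rewrite ler_pM2l//; lra.
Qed.

Lemma proper_fin_num h x : proper h -> (h x < +oo)%E -> h x \is a fin_num.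
Proof. by move=> [hNy _] hx; rewrite fin_numE hNy -ltey. Qed.

Lemma convex_fin h x z (t : R) : proper h -> convex_ereal h -> 0 <= t <= 1 ->
  h x \is a fin_num -> h z \is a fin_num ->
  h (t *: x + (1 - t) *: z) \is a fin_num /\
  fine (h (t *: x + (1 - t) *: z)) <= t * fine (h x) + (1 - t) * fine (h z).
Proof.
move=> hp hc t01 hx hz; have := hc x z t t01.
rewrite -(fineK hx) -(fineK hz) -!EFinM -EFinD /= => le1.
have fy : h (t *: x + (1 - t) *: z) \is a fin_num.
  by apply: proper_fin_num => //; apply: le_lt_trans le1 (ltry _).
by split=> //; rewrite -lee_fin fineK.
Qed.

Lemma prox_fin_num (B : 'M[R]_N) (kappa : R) h x p : 0 < kappa -> proper h ->
  is_prox B (fun z => (kappa%:E * h z)%E) x p -> h p \is a fin_num.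
Proof.
move=> k0 hp pp; apply: proper_fin_num => //.
have [z hz] := hp.2; have := pp z.
rewrite -(fineK (proper_fin_num hp hz)) -EFinM -EFinD => le1.
rewrite ltey; apply/eqP => hpy; move: le1.
by rewrite hpy gt0_muley ?lte_fin// addye// leye_eq.
Qed.

(** Optimality of [p] is tested at [t z + (1 - t) p]; convexity makes the gain linear in [t], and
    the quadratic remainder vanishes by [le0_of_le_sqr]. *)
Lemma prox_variational (B : 'M[R]_N) (kappa : R) h x p z : 0 < kappa -> B^T = B ->
  proper h -> convex_ereal h ->
  is_prox B (fun z => (kappa%:E * h z)%E) x p -> h z \is a fin_num ->
  kappa * (fine (h p) - fine (h z)) <= dot (B *m (p - x)) (z - p).
Proof.
move=> k0 sB hp hc pp hz; have hfp := prox_fin_num k0 hp pp.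
rewrite -subr_le0; set v := z - p.
apply: (@le0_of_le_sqr _ (2^-1 * sqnormB B v)) => t /andP[t0 t1].
have t01 : 0 <= t <= 1 by rewrite !ltW.
have [hfy hy] := convex_fin hp hc t01 hz hfp.
have := pp (t *: z + (1 - t) *: p).
rewrite -(fineK hfp) -(fineK hfy) -!EFinM -!EFinD lee_fin => le1.
have le2 := ler_wpM2l (ltW k0) hy.
have := le_trans le1 (lerD le2 (lexx _)).
have -> : x - (t *: z + (1 - t) *: p) = - (p - x + t *: v).
  by apply/matrixP => i j; rewrite !mxE; ring.
rewrite -(opprB p x); move: (p - x) => u; clearbody v.
rewrite /sqnormB !mulmxN !dotNl !dotNr !opprK mulmxDr -scalemxAr !dot_linE.
rewrite dot_mulmx sB.
have : dot v (B *m u) = dot u (B *m v) by rewrite dotC dot_mulmx sB.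
move=> ->.
lra.
Qed.

Lemma argmin_fin_num f h x xs : proper h -> h x \is a fin_num ->
  is_argmin (objective f h) xs -> h xs \is a fin_num.
Proof.
move=> hp hx ms; apply: proper_fin_num => //.
have := ms x; rewrite /objective -(fineK hx) -EFinD => le1.
by rewrite ltey; apply/eqP => hy; move: le1; rewrite hy addey// leye_eq.
Qed.

Lemma fine_objective f h x : h x \is a fin_num ->
  fine (objective f h x) = f x + fine (h x).
Proof. by move=> hx; rewrite /objective -{1}(fineK hx). Qed.

(** Minimality of [xs] is tested on the segment towards [x]: the strong convexity term carries t (1
    - t), and its t^2 part is discarded by [le0_of_le_sqr]. *)
Lemma argmin_growth (mu : R) f h x xs : strongly_convex mu f ->
  proper h -> convex_ereal h -> h x \is a fin_num ->
  is_argmin (objective f h) xs ->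
  mu / 2 * dot (x - xs) (x - xs) <= fine (objective f h x) - fine (objective f h xs).
Proof.
move=> sc hp hc hx ms; have hs := argmin_fin_num hp hx ms.
rewrite !fine_objective// -subr_le0.
set q := dot _ _; apply: (@le0_of_le_sqr _ (mu / 2 * q)) => t /andP[t0 t1].
have t01 : 0 <= t <= 1 by rewrite !ltW.
have [hfy hy] := convex_fin hp hc t01 hx hs.
have := sc x xs t t01; rewrite enorm_sqr -/q.
have := ms (t *: x + (1 - t) *: xs).
rewrite /objective -(fineK hs) -(fineK hfy) -!EFinD lee_fin.
rewrite /=.
lra.
Qed.

End extended_valued.

(** * Decrease of the objective in one variable-metric forward-backward step *)

Section forward_backward_step.
Variables (R : realType) (N : nat) (f : 'cV[R]_N -> R) (h : 'cV[R]_N -> \bar R).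
Variables (mu L b kappa kappa_sup : R) (H : 'M[R]_N) (x p : 'cV[R]_N).
Hypotheses (f_diff : forall x, differentiable (f : 'cV[R]_N -> R^o) x).
Hypotheses (f_strong : strongly_convex mu f) (grad_lip : elipschitz L (grad f)).
Hypotheses (h_proper : proper h) (h_convex : convex_ereal h).
Hypotheses (L_gt0 : 0 < L) (kappa_gt0 : 0 < kappa).
Hypotheses (kappa_le : kappa <= kappa_sup) (H_sym : H^T = H).
Hypothesis (H_le : spectral_le b H).
Hypotheses (x_fin : h x \is a fin_num).
Hypothesis p_prox : is_prox (invmx H) (fun z => (kappa%:E * h z)%E)
  (x - kappa *: (H *m grad f x)) p.

Local Notation F z := (fine (objective f h z)).
Local Notation alpha := (1 - L * b * kappa_sup / 2).
Local Notation q v := (dot v (invmx H *m v)).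

(** Change of the model that linearizes f at [x] and keeps h exact. *)
Definition model_decrease := dot (grad f x) (p - x) + (fine (h p) - fine (h x)).

Lemma step_variational (a0 : R) z : 0 < a0 -> spectral_ge a0 H -> h z \is a fin_num ->
  fine (h p) - fine (h z) + dot (grad f x) (p - z) <=
  kappa^-1 * dot (invmx H *m (p - x)) (z - p).
Proof.
move=> a00 Ha hz; have Hu := spectral_ge_unitmx a00 Ha.
have sB : (invmx H)^T = invmx H by rewrite trmx_inv H_sym.
have := prox_variational kappa_gt0 sB h_proper h_convex p_prox hz.
rewrite opprB addrCA addrC mulmxDr -scalemxAr mulKmx// dotDl dotZl.
rewrite -(opprB z p) dotNr ler_pdivlMl//.
move: (grad f x) => g.
lra.
Qed.

Lemma model_decrease_le (a0 : R) : 0 < a0 -> spectral_ge a0 H ->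
  model_decrease <= - (kappa^-1 * q (p - x)).
Proof.
move=> a00 Ha; have := step_variational a00 Ha x_fin.
rewrite -(opprB p x) dotNr [dot (invmx H *m _) _]dotC /model_decrease.
move: (grad f x) => g; lra.
Qed.

(** The quadratic term of the descent lemma is measured in the metric of H^-1, where |d|^2 <= b <d,
    H^-1 d>; then 1 - alpha = L b kappa_sup / 2 and kappa <= kappa_sup. *)
Lemma objective_step_le (a0 : R) : 0 < b -> 0 < a0 -> spectral_ge a0 H ->
  F p <= F x + model_decrease + (1 - alpha) * (kappa^-1 * q (p - x)).
Proof.
move=> b0 a00 Ha; rewrite !fine_objective//; last exact: prox_fin_num p_prox.
have := lipschitz_grad_ub f_diff x p grad_lip.
have := spectral_le_inv a00 b0 H_sym Ha H_le (p - x).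
rewrite /model_decrease ler_pdivrMl//.
move: (grad f x) => g; set d := dot (p - x) (p - x) => hd.
have d0 : 0 <= d := dot_ge0 _.
have q0 : 0 <= q (p - x) by rewrite -(pmulr_rge0 _ b0); apply: le_trans hd.
suff : L / 2 * d <= (1 - alpha) * (kappa^-1 * q (p - x)) by lra.
have -> : (1 - alpha) * (kappa^-1 * q (p - x)) =
    L / 2 * (b * q (p - x) * (kappa^-1 * kappa_sup)) by ring.
rewrite ler_pM2l ?divr_gt0//; apply: le_trans hd _.
rewrite ler_peMr ?mulr_ge0 ?(ltW b0)//.
by rewrite ler_pdivlMl// mulr1.
Qed.

Lemma objective_step_le_alpha (a0 : R) : 0 < b -> 0 < a0 -> alpha <= 1 ->
  spectral_ge a0 H -> F p <= F x + alpha * model_decrease.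
Proof.
move=> b0 a00 al Ha; have := objective_step_le b0 a00 Ha.
have := model_decrease_le a00 Ha => h1.
have : 0 <= (1 - alpha) * (- (kappa^-1 * q (p - x)) - model_decrease).
  by rewrite mulr_ge0// subr_ge0.
lra.
Qed.

Variables (a eta kappa_inf : R) (xs : 'cV[R]_N).
Hypotheses (mu_gt0 : 0 < mu) (a_gt0 : 0 < a) (H_ge : spectral_ge a H).
Hypotheses (kappa_inf_gt0 : 0 < kappa_inf) (kappa_ge : kappa_inf <= kappa).
Hypotheses (eta_def : eta = (2 * a * mu * kappa_inf)^-1).
Hypothesis xs_argmin : is_argmin (objective f h) xs.

Local Notation delta := (F x - F xs).

(** H^-1 is at most 1/a, quadratic growth bounds the distance, and 4 eta = 2 / (a mu kappa_inf). *)
Lemma metric_dist_le : kappa^-1 * q (xs - x) <= 4 * eta * delta.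
Proof.
have := argmin_growth f_strong h_proper h_convex x_fin xs_argmin.
rewrite -(opprB xs x) dotNl dotNr opprK.
have := spectral_ge_inv a_gt0 H_ge (xs - x).
set e := dot (xs - x) (xs - x) => he ed.
have e0 : 0 <= e := dot_ge0 _.
apply: (@le_trans _ _ (kappa_inf^-1 * (a^-1 * e))).
  apply: (@le_trans _ _ (kappa^-1 * (a^-1 * e))).
    by rewrite ler_pM2l ?invr_gt0.
  by rewrite ler_wpM2r ?mulr_ge0 ?invr_ge0 ?(ltW a_gt0)// lef_pV2.
have -> : kappa_inf^-1 * (a^-1 * e) = 4 * eta * (mu / 2 * e).
  by rewrite eta_def; field; rewrite !gt_eqF.
rewrite ler_wpM2l// mulr_ge0// eta_def invr_ge0 !mulr_ge0 //; exact: ltW.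
Qed.

Lemma model_decrease_solution (t : R) : 0 <= t <= 1 ->
  model_decrease <= - t * delta +
    kappa^-1 * (t * dot (invmx H *m (p - x)) (xs - x) - q (p - x)).
Proof.
move=> /andP[t0 t1]; have hs := argmin_fin_num h_proper x_fin xs_argmin.
have l1 := model_decrease_le a_gt0 H_ge.
have := step_variational a_gt0 H_ge hs.
have := strongly_convex_grad f_diff x xs f_strong.
rewrite !fine_objective//.
have -> : p - xs = (p - x) - (xs - x) by rewrite opprB addrA subrK.
have -> : xs - p = (xs - x) - (p - x) by rewrite opprB addrA subrK.
move: l1; rewrite /model_decrease; move: (grad f x) => g.
have := dot_ge0 (xs - x); move: (xs - x) (p - x) => e d e0.
rewrite !dotDr !dotNr [dot (invmx H *m d) d]dotC => l1 l2 l3.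
have l2' : 0 <= mu / 2 * dot e e by rewrite mulr_ge0 ?divr_ge0// ltW.
(* This is the case t = 1 and [l1] is the case t = 0; the claim is their convex combination. *)
have l4 : dot g d + (fine (h p) - fine (h x)) <=
    - (f x + fine (h x) - (f xs + fine (h xs))) +
    kappa^-1 * (dot (invmx H *m d) e - q d) by lra.
have t1' : 0 <= 1 - t by rewrite subr_ge0.
have := ler_wpM2l t0 l4; have := ler_wpM2l t1' l1.
lra.
Qed.

Lemma metric_young (t c : R) : 0 < c ->
  t * dot (invmx H *m (p - x)) (xs - x) - c * q (p - x) <= t ^+ 2 / (4 * c) * q (xs - x).
Proof.
move=> c0; have q_ge0 v : 0 <= q v.
  (* [b] has no assumed sign here, so a + |b| serves as a positive upper bound of H. *)
  have b0 : 0 < a + `|b| by rewrite ltr_wpDr.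
  have Hb : spectral_le (a + `|b|) H.
    by apply: spectral_le_trans H_le; apply: le_trans (ler_norm _) _; rewrite lerDr ltW.
  by apply: le_trans (spectral_le_inv a_gt0 b0 H_sym H_ge Hb v);
     rewrite mulr_ge0 ?invr_ge0 ?dot_ge0// ltW.
have := q_ge0 (t *: (xs - x) - (2 * c) *: (p - x)).
move: (xs - x) (p - x) => e d.
rewrite mulmxBr -!scalemxAr !dot_linE.
have sB : (invmx H)^T = invmx H by rewrite trmx_inv H_sym.
have -> : dot e (invmx H *m d) = dot (invmx H *m d) e by rewrite dotC.
have -> : dot d (invmx H *m e) = dot (invmx H *m d) e by rewrite dot_mulmx sB.
have -> : t ^+ 2 / (4 * c) * dot e (invmx H *m e) =
   (4 * c)^-1 * (t ^+ 2 * dot e (invmx H *m e)) by ring.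
rewrite ler_pdivlMl ?mulr_gt0//.
lra.
Qed.

(** Young's inequality with c = 1 spends the whole term -|d|_B^2 on the cross term, leaving t^2/4
    times 4 eta delta. *)
Lemma sufficient_decrease_contraction (t : R) : 0 <= t <= 1 -> 0 < b -> 0 <= alpha <= 1 ->
  F p - F xs <= (1 - alpha * (t - eta * t ^+ 2)) * delta.
Proof.
move=> t01 b0 /andP[al0 al1].
have := objective_step_le_alpha b0 a_gt0 al1 H_ge.
have := model_decrease_solution t01.
have := metric_young t ltr01; rewrite mul1r mulr1.
have := metric_dist_le.
have k0 : 0 < kappa^-1 by rewrite invr_gt0.
set D := model_decrease.
move=> l1 /(ler_wpM2l (ltW k0)) l2 l3 l4.
have l5 : t ^+ 2 / 4 * (kappa^-1 * q (xs - x)) <= t ^+ 2 / 4 * (4 * eta * (F x - F xs)).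
  by rewrite ler_wpM2l// divr_ge0// sqr_ge0.
have l6 : D <= - (t - eta * t ^+ 2) * (F x - F xs) by lra.
have := ler_wpM2l al0 l6.
lra.
Qed.

(** Since 1 - alpha <= 1/2, half of -|d|_B^2 pays for the descent lemma; the other half is used in
    Young's inequality with c = 1/2, leaving t^2/2 times 4 eta delta. *)
Lemma majorization_contraction (t : R) : 0 <= t <= 1 -> 0 < b -> 1 / 2 <= alpha ->
  F p - F xs <= (1 - (t - 2 * eta * t ^+ 2)) * delta.
Proof.
move=> t01 b0 al.
have := objective_step_le b0 a_gt0 H_ge.
have := model_decrease_solution t01.
have h2 : (0 : R) < 2^-1 by rewrite invr_gt0.
have := metric_young t h2; have -> : 4 * 2^-1 = 2 :> R by field.
have := metric_dist_le.
have k0 : 0 < kappa^-1 by rewrite invr_gt0.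
set D := model_decrease.
move=> l1 /(ler_wpM2l (ltW k0)) l2 l3 l4.
have l5 : t ^+ 2 / 2 * (kappa^-1 * q (xs - x)) <= t ^+ 2 / 2 * (4 * eta * (F x - F xs)).
  by rewrite ler_wpM2l// divr_ge0// sqr_ge0.
have q0 : 0 <= (alpha - 1 / 2) * (kappa^-1 * q (p - x)).
  rewrite mulr_ge0 ?subr_ge0// mulr_ge0 ?(ltW k0)//.
  apply: le_trans (spectral_le_inv a_gt0 b0 H_sym H_ge H_le (p - x)).
  by rewrite mulr_ge0 ?dot_ge0 ?invr_ge0 ?(ltW b0).
lra.
Qed.

End forward_backward_step.

(** * Uniform bounds on the matrices of the algorithm *)

Section zsr1_metric.
Variables (R : realType) (N : nat) (f : 'cV[R]_N -> R).
Variables (mu L gamma tmin tmax tau : R) (x : nat -> 'cV[R]_N).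
Hypotheses (f_diff : forall x, differentiable (f : 'cV[R]_N -> R^o) x).
Hypotheses (mu_gt0 : 0 < mu) (L_gt0 : 0 < L) (gamma01 : 0 < gamma < 1).
Hypotheses (f_strong : strongly_convex mu f) (grad_lip : elipschitz L (grad f)).
Let a := gamma * L^-1.
Let b := ((1 + gamma) * mu^-1 - 2 * gamma * L^-1) / (1 - gamma).
Hypotheses (tmin_gt0 : 0 < tmin) (tmin_L : tmin <= L^-1) (tmax_L : L^-1 <= tmax).
Hypotheses (a_tau : a <= tau) (tau_b : tau <= b).

(** Cocoercivity puts the Barzilai-Borwein quotient above 1/L; strong monotonicity with
    Cauchy-Schwarz puts it below 1/mu. As tmin <= 1/L <= tmax, the projection stays above 1/L and
    never increases the quotient. *)
Lemma bb2_scale_bounds (s y : 'cV[R]_N) : 0 < dot y y ->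
  L^-1 * dot y y <= dot s y -> mu * dot s s <= dot s y ->
  let c := bb2_scale gamma tmin tmax s y in
  [/\ a <= c, c <= gamma * mu^-1, c * dot y y <= gamma * dot s y & L^-1 <= mu^-1].
Proof.
move=> y0 coco mono c; have [g0 g1] := andP gamma01.
have L0 : 0 < L^-1 by rewrite invr_gt0.
have P0 : 0 < dot s y by apply: lt_le_trans coco; rewrite mulr_gt0.
have Pmu : dot s y <= mu^-1 * dot y y.
  rewrite -(ler_pM2l P0) -expr2; apply: le_trans (dot_CS s y) _.
  rewrite mulrA ler_pM2r// mulrC ler_pdivlMl//.
have tauL : L^-1 <= dot s y / dot y y by rewrite ler_pdivlMr.
have taumu : dot s y / dot y y <= mu^-1 by rewrite ler_pdivrMr.
have pL : L^-1 <= project tmin tmax (dot s y / dot y y).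
  by rewrite /project le_max le_min tmax_L tauL orbT.
have ptau : project tmin tmax (dot s y / dot y y) <= dot s y / dot y y.
  by rewrite /project ge_max ge_min lexx orbT andbT (le_trans tmin_L).
rewrite /c /bb2_scale enorm_sqr; split.
- by rewrite ler_pM2l.
- by rewrite ler_pM2l// (le_trans ptau).
- by rewrite -mulrA ler_pM2l// -ler_pdivlMr.
- exact: le_trans taumu.
Qed.

(* The lower bound [a] may fail when the gradient pair vanishes, but then the
   last two iterates coincide. *)
Lemma zsr1_H_spectral k : let H := zsr1_H gamma tmin tmax tau (grad f) x k in
  [/\ H^T = H, exists2 a0, 0 < a0 & spectral_ge a0 H, spectral_le b H &
      spectral_ge a H \/ ((1 < k)%N /\ x k = x k.-1)].
Proof.
have [g0 g1] := andP gamma01.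
have L0 : 0 < L^-1 by rewrite invr_gt0.
have a0 : 0 < a by rewrite mulr_gt0.
have ge_scalar c c' : c' <= c -> spectral_ge c' (c%:M : 'M[R]_N).
  by move=> cc v; rewrite dot_scalar_mx ler_wpM2r ?dot_ge0.
have le_scalar c c' : c <= c' -> spectral_le c' (c%:M : 'M[R]_N).
  by move=> cc v; rewrite dot_scalar_mx ler_wpM2r ?dot_ge0.
rewrite /zsr1_H; case: ifPn => [_|]; rewrite /=.
  rewrite tr_scalar_mx; split=> //.
  - by exists a => //; exact: ge_scalar.
  - exact: le_scalar.
  - by left; exact: ge_scalar.
rewrite -ltnNge => k1.
have := grad_cocoercive f_diff (x k.-1) (x k) (ltW mu_gt0) L_gt0 f_strong grad_lip.
have := grad_strongly_monotone f_diff (x k.-1) (x k) f_strong.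
move: (grad f (x k)) (grad f (x k.-1)) => gk gk1.
move sE : (x k - x k.-1) => s; move: (gk - gk1) => y mono coco.
rewrite trmx_sr1.
have := dot_ge0 y; rewrite le_eqVlt => /orP[/eqP/esym y0|y0]; last first.
  have [ca cmu cy Lmu] := bb2_scale_bounds y0 coco mono.
  set c := bb2_scale _ _ _ _ _ in ca cmu cy *.
  have Hc : spectral_ge c (sr1_matrix c%:M s y) := @sr1_spectral_ge _ _ c s y.
  have c0 : 0 < c by exact: lt_le_trans ca.
  split=> //.
  - by exists c.
  - have P0 : 0 < dot s y by apply: lt_le_trans coco; rewrite mulr_gt0.
    apply: spectral_le_trans (sr1_spectral_le gamma01 mu_gt0 (ltW c0) P0 mono cmu cy).
    have g1' : 0 < 1 - gamma by rewrite subr_gt0.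
    rewrite /b ler_pM2r ?invr_gt0//.
    (* The numerator of [b] is (1/mu - gamma/L) + gamma (1/mu - 1/L), and c >= gamma/L. *)
    have : gamma * L^-1 <= gamma * mu^-1 by rewrite ler_pM2l.
    move: ca; rewrite /a; lra.
  - by left => v; apply: le_trans (Hc v); rewrite ler_wpM2r ?dot_ge0.
(* Degenerate pair y = 0: strong monotonicity forces s = 0, the quotient 0/0 is 0 and projects to
   tmin, and the update is skipped because its test reads 0 <= 0. *)
have {}y0 := dot_eq0 y0; rewrite y0 dot0r in mono coco *.
have s0 : s = 0.
  apply: dot_eq0; apply/eqP; rewrite eq_le dot_ge0 andbT.
  by rewrite -(pmulr_rle0 _ mu_gt0).
have -> : bb2_scale gamma tmin tmax s 0 = gamma * tmin.
  rewrite /bb2_scale dot0r mul0r /project; congr (_ * _); apply/max_idPl.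
  by rewrite ge_min (ltW tmin_gt0) orbT.
have -> : sr1_matrix (gamma * tmin)%:M s 0 = (gamma * tmin)%:M.
  rewrite /sr1_matrix /sr1_vector dot0r ifT ?mul0mx ?addr0//.
  by rewrite !mulr_ge0 ?enorm_ge0// invr_ge0 exprn_ge0.
have gt0 : 0 < gamma * tmin by rewrite mulr_gt0.
split=> //.
- by exists (gamma * tmin) => //; exact: ge_scalar.
- apply: le_scalar; apply: le_trans (le_trans a_tau tau_b).
  by rewrite /a ler_pM2l.
- by right; split=> //; apply/eqP; rewrite -subr_eq0 sE s0.
Qed.

End zsr1_metric.

(** * Choice of [t] and elementary bounds on the rates *)

Section rates.
Variable R : realType.
Implicit Types alpha eta : R.

Lemma rate1_gt0_lt1 eta : 0 < eta ->
  0 < 1 - 2 * (Num.sqrt (eta ^+ 2 + eta) - eta) < 1.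
Proof.
move=> e0; have e2 : 0 <= eta ^+ 2 + eta by rewrite addr_ge0 ?sqr_ge0// ltW.
have := sqr_sqrtr e2; have := sqrtr_ge0 (eta ^+ 2 + eta).
set s := Num.sqrt _ => s0 s2.
have h1 : s < eta + 1 / 2.
  by rewrite -(ltr_pXn2r (n := 2)) ?nnegrE//; [rewrite s2; lra|lra].
have h2 : eta < s by rewrite -(ltr_pXn2r (n := 2)) ?nnegrE ?(ltW e0)// s2; lra.
by apply/andP; split; lra.
Qed.

Lemma rate1_attained eta : 0 < eta -> exists2 t : R, 0 <= t <= 1 &
  1 - 2 * (Num.sqrt (eta ^+ 2 + eta) - eta) <= t - eta * t ^+ 2.
Proof.
move=> e0; have e2 : 0 <= eta ^+ 2 + eta by rewrite addr_ge0 ?sqr_ge0// ltW.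
have := sqr_sqrtr e2; have := sqrtr_ge0 (eta ^+ 2 + eta).
set s := Num.sqrt _ => s0 s2.
(* The maximizer of t - eta t^2 on [0,1] is 1 when eta <= 1/2 and 1/(2 eta) otherwise. *)
have [he|he] := leP eta (1 / 2).
  exists 1; first by rewrite ler01 lexx.
  suff : 3 * eta <= 2 * s by rewrite expr1n; lra.
  rewrite -(ler_pXn2r (n := 2)) ?nnegrE//; [|lra|lra].
  rewrite !exprMn s2; have : eta * eta <= eta * (1 / 2) by rewrite ler_pM2l.
  lra.
exists (1 / (2 * eta)).
  by rewrite divr_ge0 ?mulr_ge0 ?(ltW e0)//= ler_pdivrMr ?mulr_gt0//; lra.
have -> : 1 / (2 * eta) - eta * (1 / (2 * eta)) ^+ 2 = 1 / (4 * eta).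
  by field; rewrite gt_eqF.
rewrite ler_pdivlMr ?mulr_gt0//.
suff : 8 * eta ^+ 2 + 4 * eta - 1 <= 8 * eta * s by lra.
(* This makes the left-hand side nonnegative, so squaring is allowed; what remains is 1 <= 8 eta. *)
have ee : 1 / 4 <= eta ^+ 2.
  have -> : 1 / 4 = (1 / 2) ^+ 2 :> R by field.
  by rewrite ler_pXn2r ?nnegrE//; lra.
rewrite -(ler_pXn2r (n := 2)) ?nnegrE//; [|lra|by rewrite !mulr_ge0 ?(ltW e0)].
rewrite !exprMn s2; lra.
Qed.

(** The minimizer of 1 - t + 2 eta t^2 on [0,1] is 1 when eta <= 1/4 and 1/(4 eta) otherwise. *)
Lemma rate2_attained eta : 0 < eta -> exists2 t : R, 0 <= t <= 1 &
  1 - (t - 2 * eta * t ^+ 2) = if eta <= 1 / 4 then 2 * eta else 1 - 1 / (8 * eta).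
Proof.
move=> e0; case: ifPn => [he|]; last rewrite -ltNge => he.
  by exists 1; [rewrite ler01 lexx|rewrite expr1n; ring].
exists (1 / (4 * eta)); last by field; rewrite gt_eqF.
by rewrite divr_ge0 ?mulr_ge0 ?(ltW e0)//= ler_pdivrMr ?mulr_gt0//; lra.
Qed.

Lemma rate2_gt0_lt1 eta : 0 < eta ->
  0 < (if eta <= 1 / 4 then 2 * eta else 1 - 1 / (8 * eta)) < 1.
Proof.
move=> e0; case: ifPn => [he|]; last rewrite -ltNge => he.
  by apply/andP; split; lra.
have e8 : 0 < 8 * eta by rewrite mulr_gt0.
by rewrite ltrBlDr ltrDl divr_gt0// subr_gt0 ltr_pdivrMr// andbT; lra.
Qed.

End rates.

(** * Linear convergence of the iterates *)

Lemma reachedW (R : realType) (N : nat) (eps : R) (x xbar : nat -> 'cV[R]_N) k :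
  reached eps x xbar k.+1 -> reached eps x xbar k.
Proof. by move=> r j /andP[j1 jk]; apply: r; rewrite j1 ltnS ltnW. Qed.

Theorem theorem4p2 (R : realType) (N : nat) (N_gt0 : (0 < N)%N)
  (f : 'cV[R]_N -> R) (h : 'cV[R]_N -> \bar R)
  (f_Gamma0 : Gamma0 (fun x => (f x)%:E)) (h_Gamma0 : Gamma0 h)
  (argmin_F : exists z, is_argmin (objective f h) z)
  (mu L : R) (mu_gt0 : 0 < mu) (L_gt0 : 0 < L)
  (f_C1 : C1 f) (grad_lip : elipschitz L (grad f))
  (f_strong : strongly_convex mu f)
  (gamma tmin tmax tau eps : R) (gamma01 : 0 < gamma < 1)
  (tmin_gt0 : 0 < tmin) (tmin_tmax : tmin < tmax)
  (tau_gt0 : 0 < tau) (eps_ge0 : 0 <= eps)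
  (kappa : nat -> R) (kappa_inf kappa_sup : R)
  (x xbar : nat -> 'cV[R]_N) :
  let a := gamma * L^-1 in
  let b := ((1 + gamma) * mu^-1 - 2 * gamma * L^-1) / (1 - gamma) in
  (* the Barzilai-Borwein safeguard and the initial scaling are compatible with
     the metric bounds a and b *)
  tmin <= L^-1 <= tmax ->
  a <= tau <= b ->
  0 < kappa_inf ->
  (forall k, kappa_inf <= kappa k <= kappa_sup) ->
  kappa_sup < 2 * (L * b)^-1 ->
  (objective f h (x 0%N) < +oo)%E ->
  zsr1_run gamma tmin tmax tau eps 1 kappa f h x xbar ->
  let alpha := 1 - L * b * kappa_sup / 2 in
  let eta := L / (2 * gamma * mu * kappa_inf) in
  let rho1 := 1 - alpha * (1 - 2 * (Num.sqrt (eta ^+ 2 + eta) - eta)) in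
  let rho2 := if eta <= 1 / 4 then 2 * eta else 1 - 1 / (8 * eta) in
  let rho := if alpha < 1 / 2 then rho1 else Num.min rho1 rho2 in
  0 < rho < 1 /\
  exists xstar : 'cV[R]_N,
    (forall z, is_argmin (objective f h) z <-> z = xstar) /\
    forall k, reached eps x xbar k ->
      enorm (x k - xstar) <=
        Num.sqrt (2 * (fine (objective f h (x 0%N)) -
                       fine (objective f h xstar)) / mu)
        * rho `^ (k%:R / 2).
Proof.
move=> a b /andP[tminL tmaxL] /andP[a_tau tau_b] ki0 kappaP ks Fx0 run.
move=> alpha eta rho1 rho2 rho.
have [h_proper _ h_convex] := h_Gamma0.
have [f_diff _] := f_C1.
have [g0 g1] := andP gamma01.
have a0 : 0 < a by rewrite mulr_gt0 ?invr_gt0.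
have b0 : 0 < b by apply: lt_le_trans (le_trans a_tau tau_b).
have ks0 : 0 < kappa_sup.
  by have /andP[k1 k2] := kappaP 0%N; apply: lt_le_trans ki0 (le_trans k1 k2).
have al0 : 0 < alpha.
  have Lb0 : 0 < L * b by rewrite mulr_gt0.
  by move: ks; rewrite ltr_pdivlMr// /alpha; lra.
have al1 : alpha < 1.
  by have := mulr_gt0 (mulr_gt0 L_gt0 b0) ks0; rewrite /alpha; clearbody b; lra.
have eta0 : 0 < eta by rewrite divr_gt0 ?mulr_gt0.
have etaE : eta = (2 * a * mu * kappa_inf)^-1.
  by rewrite /eta /a; field; rewrite !gt_eqF.
have /andP[phi0 phi1] := rate1_gt0_lt1 eta0.
have /andP[r20 r21] := rate2_gt0_lt1 eta0; rewrite -/rho2 in r20 r21.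
have r10 : 0 < rho1.
  have : alpha * (1 - 2 * (Num.sqrt (eta ^+ 2 + eta) - eta)) < 1 * 1.
    by rewrite ltr_pM // ltW.
  rewrite /rho1; lra.
have r11 : rho1 < 1 by rewrite /rho1 ltrBlDr ltrDl mulr_gt0.
have rho01 : 0 < rho < 1.
  by rewrite /rho; case: ifP => _; rewrite ?lt_min ?gt_min ?r10 ?r11 ?r20.
split=> //; have [rho0 _] := andP rho01.
have hx0 : h (x 0%N) \is a fin_num.
  apply: proper_fin_num => //; move: Fx0; rewrite /objective.
  by rewrite !ltey; apply: contraNN => /eqP ->; rewrite addey.
have [xs xs_min] := argmin_F.
pose F z := fine (objective f h z).
have growth z : h z \is a fin_num -> mu / 2 * dot (z - xs) (z - xs) <= F z - F xs.
  by move=> hz; apply: argmin_growth.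
have F_ge z : h z \is a fin_num -> 0 <= F z - F xs.
  by move=> hz; apply: le_trans (growth _ hz); rewrite mulr_ge0 ?dot_ge0// divr_ge0 ?ltW.
have mu2 : 0 < mu / 2 by rewrite divr_gt0.
exists xs; split.
  move=> z; split=> [zm|->//].
  have hz : h z \is a fin_num := argmin_fin_num h_proper hx0 zm.
  have := growth z hz; rewrite /F.
  have -> : objective f h z = objective f h xs by apply/le_anti; rewrite zm xs_min.
  rewrite subrr pmulr_rle0// => d0; apply/eqP; rewrite -subr_eq0; apply/eqP.
  by apply: dot_eq0; apply/eqP; rewrite eq_le d0 dot_ge0.
(* The induction carries the contraction of the preceding step, which the case of a repeated iterate
   needs. *)
have step k : reached eps x xbar k -> h (x k) \is a fin_num /\
    ((0 < k)%N -> F (x k) - F xs <= rho * (F (x k.-1) - F xs)).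
  elim: k => [//|k IH] rk1; have rk := reachedW rk1.
  have [hxk dk] := IH rk; have [pk /(_ rk1)] := run k rk.
  rewrite scale1r addrC subrK => xk1; rewrite -xk1 in pk.
  have /andP[kk1 kk2] := kappaP k; have kk0 : 0 < kappa k by exact: lt_le_trans kk1.
  have hp := prox_fin_num kk0 h_proper pk; split=> // _ /=.
  have [Hs [a1 a10 Ha1] Hb Ha] := zsr1_H_spectral x f_diff mu_gt0 L_gt0 gamma01 f_strong
    grad_lip tmin_gt0 tminL tmaxL a_tau tau_b k.
  set H := zsr1_H _ _ _ _ _ _ _ in pk Hs Ha1 Hb Ha.
  (* If x_k = x_{k-1}, the preceding contraction with rho < 1 forces F(x_k) = F(xs); the next step
     does not increase F, so both sides of the goal behave as zero. *)
  have [{}Ha|[k1 xkk]] := Ha; last first.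
    have dk0 : F (x k) - F xs = 0.
      apply/eqP; rewrite eq_le F_ge// andbT.
      have := dk (ltnW k1); rewrite -xkk; have [_ r1] := andP rho01.
      rewrite -subr_le0 -{1}[_ - F xs]mul1r -mulrBl pmulr_rle0 ?subr_gt0//.
    rewrite dk0 mulr0.
    have := objective_step_le_alpha f_diff grad_lip h_proper h_convex
      L_gt0 kk0 kk2 Hs Hb hxk pk b0 a10 (ltW al1) Ha1.
    have := model_decrease_le h_proper h_convex kk0 Hs hxk pk a10 Ha1.
    have : 0 <= (kappa k)^-1 * dot (x k.+1 - x k) (invmx H *m (x k.+1 - x k)).
      rewrite mulr_ge0 ?invr_ge0 ?(ltW kk0)//.
      apply: le_trans (spectral_le_inv a10 b0 Hs Ha1 Hb _).
      by rewrite mulr_ge0 ?dot_ge0 ?invr_ge0 ?(ltW b0).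
    rewrite -/(F _) -/(F _) -/alpha; set D := model_decrease _ _ _ _ => q0 Dq.
    have D0 : alpha * D <= 0 by rewrite pmulr_rle0//; lra.
    move: dk0; lra.
  have al01 : 0 <= alpha <= 1 by rewrite !ltW.
  have dk0 := F_ge _ hxk.
  have c1 : F (x k.+1) - F xs <= rho1 * (F (x k) - F xs).
    have [t t01 ht] := rate1_attained eta0.
    have := sufficient_decrease_contraction f_diff f_strong grad_lip h_proper h_convex
      L_gt0 kk0 kk2 Hs Hb hxk pk mu_gt0 a0 Ha ki0 kk1 etaE xs_min t01 b0 al01.
    move=> /le_trans; apply; rewrite ler_wpM2r// /rho1 lerD2l lerN2.
    by rewrite ler_pM2l.
  rewrite /rho; case: ifPn => [//|]; rewrite -leNgt => al2.
  have c2 : F (x k.+1) - F xs <= rho2 * (F (x k) - F xs).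
    have [t t01 ht] := rate2_attained eta0.
    have := majorization_contraction f_diff f_strong grad_lip h_proper h_convex
      L_gt0 kk0 kk2 Hs Hb hxk pk mu_gt0 a0 Ha ki0 kk1 etaE xs_min t01 b0 al2.
    by rewrite ht.
  by rewrite minEle; case: ifP.
have lin k : reached eps x xbar k -> F (x k) - F xs <= rho ^+ k * (F (x 0%N) - F xs).
  elim: k => [|k IH] rk; first by rewrite expr0 mul1r.
  have [_ /(_ isT) /le_trans] := step _ rk; apply.
  by rewrite exprS -mulrA ler_pM2l//; apply: IH; exact: reachedW rk.
move=> k rk; have [hxk _] := step k rk.
(* Both factors become square roots, so the claim reduces to growth combined with [lin]. *)
have -> : rho `^ (k%:R / 2) = Num.sqrt (rho ^+ k).
  by rewrite powRrM powR_mulrn ?powR12_sqrt ?exprn_ge0 ?ltW.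
have d0 := F_ge _ hx0.
have d0' : 0 <= 2 * (F (x 0%N) - F xs) / mu.
  by rewrite (divr_ge0 _ (ltW mu_gt0)) ?mulr_ge0.
rewrite -/(F _) -/(F _) -sqrtrM//; apply: ler_wsqrtr.
have := le_trans (growth _ hxk) (lin k rk); rewrite -ler_pdivlMl//.
move=> /le_trans; apply; rewrite le_eqVlt; apply/orP; left; apply/eqP.
by field; rewrite gt_eqF.
Qed.
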